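(* Let $S$ be a set, $\mathbf{M}$ an $S$-distributive monoidal category, and $\mathbf{A},\mathbf{B}$ two $\mathbf{M}$-categories with object set $S$. Let $|\cdots|:S^3\to S$ be a function and let ${}_x\widetilde{R}_z^y:{}_xB_y\otimes{}_yA_z\to{}_xA_{|xyz|}\otimes{}_{|xyz|}B_z$ ($x,y,z\in S$) be morphisms in $\mathbf{M}$. Consider the following four conditions (for all $x,y,z,t\in S$): (i) If ${}_xB_y\otimes{}_yB_z\otimes{}_zA_t$ is not an initial object, then $|xy|yzt||=|xzt|$ and $$({}_xA_{|xzt|}\otimes{}_{|xzt|}b_t^{|yzt|})\circ({}_x\widetilde{R}_{|yzt|}^y\otimes{}_{|yzt|}B_t)\circ({}_xB_y\otimes{}_y\widetilde{R}_t^z)={}_x\widetilde{R}_t^z\circ({}_xb_z^y\otimes{}_zA_t).$$ (ii) If ${}_xB_y\otimes{}_yA_z\otimes{}_zA_t$ is not an initial object, then $||xyz|zt|=|xyt|$ and $$({}_xa_{|xyt|}^{|xyz|}\otimes{}_{|xyt|}B_t)\circ({}_xA_{|xyz|}\otimes{}_{|xyz|}\widetilde{R}_t^z)\circ({}_x\widetilde{R}_z^y\otimes{}_zA_t)={}_x\widetilde{R}_t^y\circ({}_xB_y\otimes{}_ya_t^z).$$ (iii) If ${}_xA_y$ is not an initial object, then $|xxy|=y$ and ${}_x\widetilde{R}_y^x\circ(1_x^B\otimes{}_xA_y)={}_xA_y\otimes1_y^B$. (iv) If ${}_xB_y$ is not an initial object, then $|xyy|=x$ and ${}_x\widetilde{R}_y^y\circ({}_xB_y\otimes1_y^A)=1_x^A\otimes{}_xB_y$.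 Then conditions (i)-(iv) imply that for all $x,y,z,t\in S$ the following four relations hold: $${}_x\sigma_t^{|xy|yzt||}\circ({}_xA_{|xy|yzt||}\otimes{}_{|xy|yzt||}b_t^{|yzt|})\circ({}_x\widetilde{R}_{|yzt|}^y\otimes{}_{|yzt|}B_t)\circ({}_xB_y\otimes{}_y\widetilde{R}_t^z)={}_x\sigma_t^{|xzt|}\circ{}_x\widetilde{R}_t^z\circ({}_xb_z^y\otimes{}_zA_t),$$ $${}_x\sigma_t^{||xyz|zt|}\circ({}_xa_{||xyz|zt|}^{|xyz|}\otimes{}_{||xyz|zt|}B_t)\circ({}_xA_{|xyz|}\otimes{}_{|xyz|}\widetilde{R}_t^z)\circ({}_x\widetilde{R}_z^y\otimes{}_zA_t)={}_x\sigma_t^{|xyt|}\circ{}_x\widetilde{R}_t^y\circ({}_xB_y\otimes{}_ya_t^z),$$ $${}_x\sigma_y^{|xxy|}\circ{}_x\widetilde{R}_y^x\circ(1_x^B\otimes{}_xA_y)={}_x\sigma_y^y\circ({}_xA_y\otimes1_y^B),$$ $${}_x\sigma_y^{|xyy|}\circ{}_x\widetilde{R}_y^y\circ({}_xB_y\otimes1_y^A)={}_x\sigma_y^x\circ(1_x^A\otimes{}_xB_y).$$ If in addition $\mathbf{M}$ satisfies hypothesis $(\dagger)$, then conversely these four relations (for all $x,y,z,t\in S$) imply conditions (i)-(iv).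
   Context: $(\mathbf{M},\otimes,\mathbf{1})$ is a monoidal category; associativity and unit constraints are suppressed, and the identity morphism of an object $X$ is also denoted $X$. $\mathbf{M}$ is $S$-distributive if every $S$-indexed family $\{X_i\}_{i\in S}$ of objects has a coproduct $(\bigoplus_{i\in S}X_i,\{\sigma_i\}_{i\in S})$ and, for every object $X$, $(X\otimes\bigoplus_iX_i,\{X\otimes\sigma_i\})$ and $((\bigoplus_iX_i)\otimes X,\{\sigma_i\otimes X\})$ are coproducts of $\{X\otimes X_i\}$ and $\{X_i\otimes X\}$. An $S$-distributive $\mathbf{M}$ satisfies hypothesis $(\dagger)$ if for every coproduct $(\bigoplus_{i\in S}X_i,\{\sigma_i\}_{i\in S})$ in $\mathbf{M}$ and all morphisms $f':X\to X_{i'}$, $f'':X\to X_{i''}$ with $\sigma_{i'}\circ f'=\sigma_{i''}\circ f''$, either $X$ is an initial object of $\mathbf{M}$, or $i'=i''$ and $f'=f''$. An $\mathbf{M}$-category $\mathbf{A}$ with object set $S$ consists of objects ${}_xA_y$ of $\mathbf{M}$ (playing the role of $\mathrm{Hom}(y,x)$), composition morphisms ${}_xa_z^y:{}_xA_y\otimes{}_yA_z\to{}_xA_z$ and identities $1_x^A:\mathbf{1}\to{}_xA_x$, satisfying the usual associativity and unit axioms; for $\mathbf{B}$ the data are ${}_xB_y,{}_xb_z^y,1_x^B$. The morphisms ${}_x\sigma_y^u:{}_xA_u\otimes{}_uB_y\to\bigoplus_{u\in S}{}_xA_u\otimes{}_uB_y$ are the canonical inclusions. *)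

(* Defs.v *)
Set Implicit Arguments.
Unset Strict Implicit.
Unset Printing Implicit Defensive.

Declare Scope cat_scope.
Delimit Scope cat_scope with cat.
Open Scope cat_scope.

Record category := Category {
  ob :> Type;
  hom : ob -> ob -> Type;
  idm : forall X, hom X X;
  comp : forall X Y Z, hom Y Z -> hom X Y -> hom X Z;
  compA : forall X Y Z T (h : hom Z T) (g : hom Y Z) (f : hom X Y),
    comp h (comp g f) = comp (comp h g) f;
  comp1m : forall X Y (f : hom X Y), comp (idm Y) f = f;
  compm1 : forall X Y (f : hom X Y), comp f (idm X) = f
}.

Arguments hom {c} X Y.
Arguments idm {c} X.
Arguments comp {c X Y Z} g f : rename.

Notation "g ∘ f" := (comp g f) (at level 40, left associativity) : cat_scope.

Definition is_initial (C : category) (X : C) : Prop :=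
  forall Y : C, exists f : hom X Y, forall g : hom X Y, g = f.

Definition is_coproduct (C : category) (I : Type) (X : I -> C) (P : C)
    (sigma : forall i, hom (X i) P) : Prop :=
  forall (Y : C) (f : forall i, hom (X i) Y),
    exists! h : hom P Y, forall i, h ∘ sigma i = f i.

(* Monoidal categories are not assumed strict: the constraints that are usually
   suppressed are explicit, each given together with its inverse. *)
Record monoidal := Monoidal {
  mcategory :> category;
  tens : mcategory -> mcategory -> mcategory;
  tensm : forall X X' Y Y' : mcategory,
    hom X X' -> hom Y Y' -> hom (tens X Y) (tens X' Y');
  unit_ob : mcategory;
  assoc : forall X Y Z, hom (tens (tens X Y) Z) (tens X (tens Y Z));
  assoc_inv : forall X Y Z, hom (tens X (tens Y Z)) (tens (tens X Y) Z);
  lunit : forall X, hom (tens unit_ob X) X;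
  lunit_inv : forall X, hom X (tens unit_ob X);
  runit : forall X, hom (tens X unit_ob) X;
  runit_inv : forall X, hom X (tens X unit_ob);
  tensm_id : forall X Y, tensm (idm X) (idm Y) = idm (tens X Y);
  tensm_comp : forall X X' X'' Y Y' Y''
      (f' : hom X' X'') (f : hom X X') (g' : hom Y' Y'') (g : hom Y Y'),
    tensm (f' ∘ f) (g' ∘ g) = tensm f' g' ∘ tensm f g;
  assocK : forall X Y Z, assoc_inv X Y Z ∘ assoc X Y Z = idm _;
  assoc_invK : forall X Y Z, assoc X Y Z ∘ assoc_inv X Y Z = idm _;
  lunitK : forall X, lunit_inv X ∘ lunit X = idm _;
  lunit_invK : forall X, lunit X ∘ lunit_inv X = idm _;
  runitK : forall X, runit_inv X ∘ runit X = idm _;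
  runit_invK : forall X, runit X ∘ runit_inv X = idm _;
  assoc_nat : forall X X' Y Y' Z Z'
      (f : hom X X') (g : hom Y Y') (h : hom Z Z'),
    assoc X' Y' Z' ∘ tensm (tensm f g) h
      = tensm f (tensm g h) ∘ assoc X Y Z;
  lunit_nat : forall X X' (f : hom X X'),
    lunit X' ∘ tensm (idm unit_ob) f = f ∘ lunit X;
  runit_nat : forall X X' (f : hom X X'),
    runit X' ∘ tensm f (idm unit_ob) = f ∘ runit X;
  pentagon : forall X Y Z T,
    assoc X Y (tens Z T) ∘ assoc (tens X Y) Z T
      = tensm (idm X) (assoc Y Z T) ∘ assoc X (tens Y Z) T
          ∘ tensm (assoc X Y Z) (idm T);
  triangle : forall X Y,
    tensm (idm X) (lunit Y) ∘ assoc X unit_ob Y = tensm (runit X) (idm Y)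
}.

Arguments tens {m} X Y : rename.
Arguments tensm {m X X' Y Y'} f g : rename.
Arguments unit_ob {m}.
Arguments assoc {m} X Y Z : rename.
Arguments assoc_inv {m} X Y Z : rename.
Arguments lunit {m} X : rename.
Arguments lunit_inv {m} X : rename.
Arguments runit {m} X : rename.
Arguments runit_inv {m} X : rename.

Notation "X ⊗ Y" := (tens X Y) (at level 34, left associativity) : cat_scope.
Notation "X ◁ f" := (tensm (idm X) f)
  (at level 34, left associativity) : cat_scope.
Notation "f ▷ X" := (tensm f (idm X))
  (at level 34, left associativity) : cat_scope.

Definition distributive (S : Type) (M : monoidal) : Prop :=
  forall X : S -> M, exists (P : M) (sigma : forall i, hom (X i) P),
    is_coproduct sigma /\
    forall Y : M,
      is_coproduct (fun i => Y ◁ sigma i) /\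
      is_coproduct (fun i => sigma i ▷ Y).

(* In the last alternative [f'] and [f''] have provably, not definitionally,
   the same type, hence the transport along [e]. *)
Definition dagger (S : Type) (M : monoidal) : Prop :=
  forall (X_ : S -> M) (P : M) (sigma : forall i, hom (X_ i) P),
    is_coproduct sigma ->
    forall (X : M) (i' i'' : S) (f' : hom X (X_ i')) (f'' : hom X (X_ i'')),
      sigma i' ∘ f' = sigma i'' ∘ f'' ->
      is_initial X \/
      exists e : i' = i'', eq_rect i' (fun i => hom X (X_ i)) f' i'' e = f''.

(* [A x y] plays the role of Hom(y, x), so that
   [ecomp A x y z : hom (A x y ⊗ A y z) (A x z)]. *)
Record enriched (M : monoidal) (S : Type) := Enriched {
  ehom :> S -> S -> M;
  ecomp : forall x y z, hom (ehom x y ⊗ ehom y z) (ehom x z);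
  eid : forall x, hom unit_ob (ehom x x);
  ecompA : forall x y z t,
    ecomp x z t ∘ (ecomp x y z ▷ ehom z t)
      = ecomp x y t ∘ (ehom x y ◁ ecomp y z t) ∘ assoc _ _ _;
  ecomp1m : forall x y, ecomp x x y ∘ (eid x ▷ ehom x y) = lunit _;
  ecompm1 : forall x y, ecomp x y y ∘ (ehom x y ◁ eid y) = runit _
}.

Arguments ecomp {M S} A x y z : rename.
Arguments eid {M S} A x : rename.

(* [tri x y z] stands for |xyz|. *)
Definition twisting (M : monoidal) (S : Type) (A B : enriched M S)
    (tri : S -> S -> S -> S) : Type :=
  forall x y z,
    hom (B x y ⊗ A y z) (A x (tri x y z) ⊗ B (tri x y z) z).

Definition cast_mid (M : monoidal) (S : Type) (A B : enriched M S)
    (X : M) (x z u v : S) (e : u = v) (f : hom X (A x u ⊗ B u z)) :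
    hom X (A x v ⊗ B v z) :=
  eq_rect u (fun w => hom X (A x w ⊗ B w z)) f v e.

Definition condition_i (M : monoidal) (S : Type) (A B : enriched M S)
    (tri : S -> S -> S -> S) (R : twisting A B tri) : Prop :=
  forall x y z t : S,
    ~ is_initial (B x y ⊗ B y z ⊗ A z t) ->
    exists e : tri x y (tri y z t) = tri x z t,
      (A x (tri x z t) ◁ ecomp B (tri x z t) (tri y z t) t)
        ∘ assoc _ _ _
        ∘ (cast_mid e (R x y (tri y z t)) ▷ B (tri y z t) t)
        ∘ assoc_inv _ _ _
        ∘ (B x y ◁ R y z t)
        ∘ assoc _ _ _
      = R x z t ∘ (ecomp B x y z ▷ A z t).

Definition condition_ii (M : monoidal) (S : Type) (A B : enriched M S)
    (tri : S -> S -> S -> S) (R : twisting A B tri) : Prop :=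
  forall x y z t : S,
    ~ is_initial (B x y ⊗ A y z ⊗ A z t) ->
    exists e : tri (tri x y z) z t = tri x y t,
      (ecomp A x (tri x y z) (tri x y t) ▷ B (tri x y t) t)
        ∘ assoc_inv _ _ _
        ∘ (A x (tri x y z) ◁ cast_mid e (R (tri x y z) z t))
        ∘ assoc _ _ _
        ∘ (R x y z ▷ A z t)
      = R x y t ∘ (B x y ◁ ecomp A y z t) ∘ assoc _ _ _.

Definition condition_iii (M : monoidal) (S : Type) (A B : enriched M S)
    (tri : S -> S -> S -> S) (R : twisting A B tri) : Prop :=
  forall x y : S,
    ~ is_initial (A x y) ->
    exists e : tri x x y = y,
      cast_mid e (R x x y) ∘ (eid B x ▷ A x y) ∘ lunit_inv _
      = (A x y ◁ eid B y) ∘ runit_inv _.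

Definition condition_iv (M : monoidal) (S : Type) (A B : enriched M S)
    (tri : S -> S -> S -> S) (R : twisting A B tri) : Prop :=
  forall x y : S,
    ~ is_initial (B x y) ->
    exists e : tri x y y = x,
      cast_mid e (R x y y) ∘ (B x y ◁ eid A y) ∘ runit_inv _
      = (eid A x ▷ B x y) ∘ lunit_inv _.

(* [sum x y] with inclusions [sigma x y u] is the coproduct over [u] of the
   objects [A x u ⊗ B u y]. *)
Definition inclusions (M : monoidal) (S : Type) (A B : enriched M S)
    (sum : S -> S -> M) : Type :=
  forall x y u, hom (A x u ⊗ B u y) (sum x y).

Definition relation_i (M : monoidal) (S : Type) (A B : enriched M S)
    (sum : S -> S -> M) (sigma : inclusions A B sum)
    (tri : S -> S -> S -> S) (R : twisting A B tri) : Prop :=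
  forall x y z t : S,
    sigma x t (tri x y (tri y z t))
      ∘ (A x (tri x y (tri y z t))
           ◁ ecomp B (tri x y (tri y z t)) (tri y z t) t)
      ∘ assoc _ _ _
      ∘ (R x y (tri y z t) ▷ B (tri y z t) t)
      ∘ assoc_inv _ _ _
      ∘ (B x y ◁ R y z t)
      ∘ assoc _ _ _
    = sigma x t (tri x z t) ∘ R x z t ∘ (ecomp B x y z ▷ A z t).

Definition relation_ii (M : monoidal) (S : Type) (A B : enriched M S)
    (sum : S -> S -> M) (sigma : inclusions A B sum)
    (tri : S -> S -> S -> S) (R : twisting A B tri) : Prop :=
  forall x y z t : S,
    sigma x t (tri (tri x y z) z t)
      ∘ (ecomp A x (tri x y z) (tri (tri x y z) z t)
           ▷ B (tri (tri x y z) z t) t)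
      ∘ assoc_inv _ _ _
      ∘ (A x (tri x y z) ◁ R (tri x y z) z t)
      ∘ assoc _ _ _
      ∘ (R x y z ▷ A z t)
    = sigma x t (tri x y t) ∘ R x y t ∘ (B x y ◁ ecomp A y z t)
        ∘ assoc _ _ _.

Definition relation_iii (M : monoidal) (S : Type) (A B : enriched M S)
    (sum : S -> S -> M) (sigma : inclusions A B sum)
    (tri : S -> S -> S -> S) (R : twisting A B tri) : Prop :=
  forall x y : S,
    sigma x y (tri x x y) ∘ R x x y ∘ (eid B x ▷ A x y) ∘ lunit_inv _
    = sigma x y y ∘ (A x y ◁ eid B y) ∘ runit_inv _.

Definition relation_iv (M : monoidal) (S : Type) (A B : enriched M S)
    (sum : S -> S -> M) (sigma : inclusions A B sum)
    (tri : S -> S -> S -> S) (R : twisting A B tri) : Prop :=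
  forall x y : S,
    sigma x y (tri x y y) ∘ R x y y ∘ (B x y ◁ eid A y) ∘ runit_inv _
    = sigma x y x ∘ (eid A x ▷ B x y) ∘ lunit_inv _.

(* Main.v *)
Require Import Defs.
From Stdlib Require Import Classical.

Set Implicit Arguments.
Unset Strict Implicit.

(** Each condition says that two morphisms [f'] and [f''] out of an object [X],
    into two summands [X_ i'] and [X_ i''] of a coproduct, coincide together with
    their indices unless [X] is initial; the corresponding relation says that they
    coincide after composition with the inclusions. If [X] is initial the latter is
    automatic, and [dagger] is precisely the converse implication. The casts in the
    conditions are transports in the index of the summand, and therefore
    commute with composition. *)

Definition same_component (S : Type) (M : monoidal) (X_ : S -> M) (X : M)
    (i' i'' : S) (f' : hom X (X_ i')) (f'' : hom X (X_ i'')) : Prop :=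
  ~ is_initial X ->
  exists e : i' = i'', eq_rect i' (fun i => hom X (X_ i)) f' i'' e = f''.

Lemma initial_hom_eq (C : category) (X Y : C) (f g : hom X Y) :
  is_initial X -> f = g.
Proof.
  intros HX; destruct (HX Y) as [h Hh].
  now rewrite (Hh f), (Hh g).
Qed.

(** Classical case split on whether [X] is initial: morphisms out of an initial object with the same
    target agree; otherwise the two indices are equal and, once they are identified, the transport
    disappears. *)
Lemma same_component_inclusions (S : Type) (M : monoidal) (X_ : S -> M) (P X : M)
    (sigma : forall i, hom (X_ i) P)
    (i' i'' : S) (f' : hom X (X_ i')) (f'' : hom X (X_ i'')) :
  same_component f' f'' -> sigma i' ∘ f' = sigma i'' ∘ f''.
Proof.
  intros H; destruct (classic (is_initial X)) as [HX | HX].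
  - now apply initial_hom_eq.
  - destruct (H HX) as [e He]; subst i''; simpl in He; now subst f''.
Qed.

Lemma dagger_same_component (S : Type) (M : monoidal) (HM : dagger S M)
    (X_ : S -> M) (P X : M) (sigma : forall i, hom (X_ i) P)
    (Hsigma : is_coproduct sigma)
    (i' i'' : S) (f' : hom X (X_ i')) (f'' : hom X (X_ i'')) :
  sigma i' ∘ f' = sigma i'' ∘ f'' -> same_component f' f''.
Proof.
  intros E HX; destruct (HM _ _ _ Hsigma _ _ _ _ _ E) as [H | H].
  - contradiction.
  - exact H.
Qed.

Section Twisting.

Variables (S : Type) (M : monoidal) (A B : enriched M S).
Variables (tri : S -> S -> S -> S) (R : twisting A B tri).

(** Named as a family in [u], with [x] and [t] fixed, so that it can be passed explicitly as [X_] to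
    [same_component]. *)
Definition summand (x t u : S) : M := A x u ⊗ B u t.

(** The condition casts only the inner factor [R x y (tri y z t)], while [same_component] transports
    the whole composite. The factors applied after the cast exist for every middle index, so the two
    agree. *)
Lemma condition_i_same_component :
  condition_i R <-> forall x y z t,
    same_component (X_ := summand x t)
      (i' := tri x y (tri y z t)) (i'' := tri x z t)
      ((A x _ ◁ ecomp B _ (tri y z t) t) ∘ assoc _ _ _
         ∘ (R x y (tri y z t) ▷ B (tri y z t) t) ∘ assoc_inv _ _ _
         ∘ (B x y ◁ R y z t) ∘ assoc _ _ _)
      (R x z t ∘ (ecomp B x y z ▷ A z t)).
Proof.
  (* With a free variable [v] as the endpoint of [e], eliminating [e] makes both sides identical. *)
  assert (T : forall x y z t v (e : tri x y (tri y z t) = v),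
    eq_rect _ (fun u => hom _ (summand x t u))
      ((A x _ ◁ ecomp B _ (tri y z t) t) ∘ assoc _ _ _
         ∘ (R x y (tri y z t) ▷ B (tri y z t) t) ∘ assoc_inv _ _ _
         ∘ (B x y ◁ R y z t) ∘ assoc _ _ _) v e
    = (A x v ◁ ecomp B v (tri y z t) t) ∘ assoc _ _ _
         ∘ (cast_mid e (R x y (tri y z t)) ▷ B (tri y z t) t) ∘ assoc_inv _ _ _
         ∘ (B x y ◁ R y z t) ∘ assoc (B x y) (B y z) (A z t))
    by (intros; now destruct e).
  split; intros H x y z t HX; destruct (H x y z t HX) as [e He]; exists e.
  - now rewrite T.
  - now rewrite <- T.
Qed.

(** Here the cast index is the last index of [ecomp A] and the first of the [B] factor beside it;
    the transport is pushed inwards past both. *)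
Lemma condition_ii_same_component :
  condition_ii R <-> forall x y z t,
    same_component (X_ := summand x t)
      (i' := tri (tri x y z) z t) (i'' := tri x y t)
      ((ecomp A x (tri x y z) _ ▷ B _ t) ∘ assoc_inv _ _ _
         ∘ (A x (tri x y z) ◁ R (tri x y z) z t) ∘ assoc _ _ _
         ∘ (R x y z ▷ A z t))
      (R x y t ∘ (B x y ◁ ecomp A y z t) ∘ assoc _ _ _).
Proof.
  assert (T : forall x y z t v (e : tri (tri x y z) z t = v),
    eq_rect _ (fun u => hom _ (summand x t u))
      ((ecomp A x (tri x y z) _ ▷ B _ t) ∘ assoc_inv _ _ _
         ∘ (A x (tri x y z) ◁ R (tri x y z) z t) ∘ assoc _ _ _
         ∘ (R x y z ▷ A z t)) v e
    = (ecomp A x (tri x y z) v ▷ B v t) ∘ assoc_inv _ _ _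
         ∘ (A x (tri x y z) ◁ cast_mid e (R (tri x y z) z t)) ∘ assoc _ _ _
         ∘ (R x y z ▷ A z t))
    by (intros; now destruct e).
  split; intros H x y z t HX; destruct (H x y z t HX) as [e He]; exists e.
  - now rewrite T.
  - now rewrite <- T.
Qed.

Lemma condition_iii_same_component :
  condition_iii R <-> forall x y,
    same_component (X_ := summand x y) (i' := tri x x y) (i'' := y)
      (R x x y ∘ (eid B x ▷ A x y) ∘ lunit_inv _)
      ((A x y ◁ eid B y) ∘ runit_inv _).
Proof.
  (* The source [A x y] depends on [y] as well, so only the index of the target summand is
     generalised to [v]. *)
  assert (T : forall x y v (e : tri x x y = v),
    eq_rect _ (fun u => hom _ (summand x y u))
      (R x x y ∘ (eid B x ▷ A x y) ∘ lunit_inv _) v e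
    = cast_mid e (R x x y) ∘ (eid B x ▷ A x y) ∘ lunit_inv _)
    by (intros; now destruct e).
  split; intros H x y HX; destruct (H x y HX) as [e He]; exists e.
  - now rewrite T.
  - now rewrite <- T.
Qed.

Lemma condition_iv_same_component :
  condition_iv R <-> forall x y,
    same_component (X_ := summand x y) (i' := tri x y y) (i'' := x)
      (R x y y ∘ (B x y ◁ eid A y) ∘ runit_inv _)
      ((eid A x ▷ B x y) ∘ lunit_inv _).
Proof.
  assert (T : forall x y v (e : tri x y y = v),
    eq_rect _ (fun u => hom _ (summand x y u))
      (R x y y ∘ (B x y ◁ eid A y) ∘ runit_inv _) v e
    = cast_mid e (R x y y) ∘ (B x y ◁ eid A y) ∘ runit_inv _)
    by (intros; now destruct e).
  split; intros H x y HX; destruct (H x y HX) as [e He]; exists e.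
  - now rewrite T.
  - now rewrite <- T.
Qed.

End Twisting.

Theorem corollary2p7 (S : Type) (M : monoidal) (HM : distributive S M)
    (A B : enriched M S)
    (sum : S -> S -> M) (sigma : inclusions A B sum)
    (Hsigma : forall x y : S, is_coproduct (sigma x y))
    (tri : S -> S -> S -> S) (R : twisting A B tri) :
  (condition_i R /\ condition_ii R /\ condition_iii R /\ condition_iv R ->
   relation_i sigma R /\ relation_ii sigma R /\
   relation_iii sigma R /\ relation_iv sigma R) /\
  (dagger S M ->
   relation_i sigma R /\ relation_ii sigma R /\
   relation_iii sigma R /\ relation_iv sigma R ->
   condition_i R /\ condition_ii R /\ condition_iii R /\ condition_iv R).
Proof.
  rewrite condition_i_same_component, condition_ii_same_component,
    condition_iii_same_component, condition_iv_same_component.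
  split.
  - intros (Hi & Hii & Hiii & Hiv); repeat split.
    + intros x y z t.
      (* This gives [sigma] composed with a bracketed composite; [compA] shifts all brackets to the
         left, as in the relation. *)
      generalize (same_component_inclusions (sigma x t) (Hi x y z t)).
      now rewrite !compA.
    + intros x y z t.
      generalize (same_component_inclusions (sigma x t) (Hii x y z t)).
      now rewrite !compA.
    + intros x y.
      generalize (same_component_inclusions (sigma x y) (Hiii x y)).
      now rewrite !compA.
    + intros x y.
      generalize (same_component_inclusions (sigma x y) (Hiv x y)).
      now rewrite !compA.
  - intros HD (Hi & Hii & Hiii & Hiv); repeat split; intros.
    (* Hypothesis [dagger] is used for the coproduct [sum x t] of the family [summand x t]. *)
    + apply (dagger_same_component HD (Hsigma x t)).
      rewrite !compA; apply Hi.
    + apply (dagger_same_component HD (Hsigma x t)).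
      rewrite !compA; apply Hii.
    + apply (dagger_same_component HD (Hsigma x y)).
      rewrite !compA; apply Hiii.
    + apply (dagger_same_component HD (Hsigma x y)).
      rewrite !compA; apply Hiv.
Qed.
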